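(* A cubic fourfold $Y\subset\mathbb{P}^5$ singular along a rational normal curve of degree $5$ is determinantal. In particular, $Y$ is also singular along a line.
   Context: We work over $\mathbb{C}$. A cubic fourfold is a hypersurface in $\mathbb{P}^5$ given by a nonzero cubic form. It is called determinantal if its equation is the determinant of a $3\times3$ matrix of linear forms in $x_0,\dots,x_5$. *)

(* Defs.v *)
From mathcomp Require Import all_boot all_order all_algebra.
From mathcomp Require Import mpoly complex reals.

Set Implicit Arguments.
Unset Strict Implicit.
Unset Printing Implicit Defensive.

Import GRing.Theory.
Local Open Scope ring_scope.

(* A point of P^n is a nonzero row vector in 'rV_n.+1 up to scaling; a subset
   of P^n is represented by the predicate holding of the vectors of homogeneous
   coordinates of its points. *)
Definition projset (K : fieldType) (n : nat) := 'rV[K]_n.+1 -> Prop.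

Definition veronese (K : fieldType) (n : nat) (s t : K) : 'rV[K]_n.+1 :=
  \row_(i < n.+1) (s ^+ (n - i) * t ^+ i).

(* The image of P^1 under the Veronese map of degree n, up to a projective     *)
(* automorphism A of P^n; c ranges over the possible rescalings of homogeneous *)
(* coordinates.                                                                *)
Definition rational_normal_curve (K : fieldType) (n : nat) (Z : projset K n) :
    Prop :=
  exists2 A : 'M[K]_n.+1, A \in unitmx &
    forall v : 'rV[K]_n.+1, Z v <->
      exists s t c : K,
        [/\ (s, t) != (0, 0), c != 0 & v = c *: (veronese n s t *m A)].

(* The projectivization of a 2-dimensional subspace (the row space of B).      *)
Definition projective_line (K : fieldType) (n : nat) (Z : projset K n) : Prop :=
  exists2 B : 'M[K]_(2, n.+1), row_free B &
    forall v : 'rV[K]_n.+1, Z v <-> v != 0 /\ (v <= B)%MS.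

(* F stands for the hypersurface F = 0.                                        *)
Definition singular_at (K : fieldType) (n : nat) (F : {mpoly K[n.+1]})
    (v : 'rV[K]_n.+1) : Prop :=
  F.@[v ord0] = 0 /\ forall i : 'I_n.+1, (F^`M(i)).@[v ord0] = 0.

Definition singular_along (K : fieldType) (n : nat) (F : {mpoly K[n.+1]})
    (Z : projset K n) : Prop :=
  forall v : 'rV[K]_n.+1, Z v -> singular_at F v.

Definition cubic_fourfold (K : fieldType) (F : {mpoly K[6]}) : Prop :=
  F != 0 /\ F \is 3.-homog.

(* The zero polynomial is 1.-homog, so entries of M may vanish.                *)
Definition determinantal (K : fieldType) (F : {mpoly K[6]}) : Prop :=
  exists2 M : 'M[{mpoly K[6]}]_3,
    (forall i j, M i j \is 1.-homog) & F = \det M.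

(* Main.v *)
(* The third derivatives of F form a symmetric tensor t with 6F = sum t_ijk x_i x_j x_k.
   In coordinates where the curve is (1 : s : ... : s^5), F is singular along it
   iff sum_(q + r = w) t_pqr = 0 for all p and w. This linear system is graded by
   the weight i + j + k and triangular; its solutions are the tensors of the
   combinations sum_l b_l m_l of the four maximal minors of the 3 x 4 Hankel matrix
   (x_(i+j)). Such a combination is det [H(x); a] for a scalar row a, hence, after
   column operations, a single 3 x 3 minor. Finally, pick (q_0, q_1, q_2) != 0 with
   q_0 a_j + q_1 a_(j+1) + q_2 a_(j+2) = 0 for j = 0, 1. On the line of all x
   satisfying the same recurrence (a secant or tangent line of the curve), the
   matrix [H(x); a] has rank at most 2, so F is singular there. *)
Require Import Defs.
From mathcomp Require Import all_boot all_order all_algebra.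
From mathcomp Require Import mpoly complex reals.
From mathcomp Require Import ring.

Set Implicit Arguments.
Unset Strict Implicit.
Unset Printing Implicit Defensive.

Import GRing.Theory Num.Theory.
Local Open Scope ring_scope.

(** * Symmetric tensors and the Hankel family *)

Definition symmetric3 (I T : Type) (t : I -> I -> I -> T) :=
  (forall i j k, t i j k = t j i k) /\ (forall i j k, t i j k = t i k j).

(* [Nat.leb] rather than [leq], so that [cbn] evaluates it on numerals. *)
Definition sort3 (T : Type) (t : nat -> nat -> nat -> T) (i j k : nat) : T :=
  if Nat.leb i j then
    if Nat.leb j k then t i j k else
    if Nat.leb i k then t i k j else t k i j
  else
    if Nat.leb i k then t j i k else
    if Nat.leb j k then t j k i else t k j i.

Lemma sort3E (T : Type) (t : nat -> nat -> nat -> T) :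
  symmetric3 t -> forall i j k, t i j k = sort3 t i j k.
Proof.
case=> s1 s2 i j k; rewrite /sort3.
case: Nat.leb; case: Nat.leb => //; case: Nat.leb => //.
- by rewrite s2 s1.
- by rewrite s1 s2.
- by rewrite s1 s2 s1.
Qed.

(* Coefficients, for i <= j <= k, of 6 times the polarization of
   b0 [012] + b1 [013] + b2 [023] + b3 [123], where [abc] is the minor on columns
   a, b, c of the 3 x 4 Hankel matrix (x_(i+j)). *)
Definition hankel_table (R : pzRingType) (b0 b1 b2 b3 : R) (i j k : nat) : R :=
  match i, j, k with
  | 0%N, 2%N, 4%N => b0
  | 0%N, 3%N, 3%N => b0 *- 2
  | 1%N, 1%N, 4%N => b0 *- 2
  | 1%N, 2%N, 3%N => b0 *+ 2
  | 2%N, 2%N, 2%N => b0 *- 6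
  | 0%N, 2%N, 5%N => b1
  | 0%N, 3%N, 4%N => - b1
  | 1%N, 1%N, 5%N => b1 *- 2
  | 1%N, 2%N, 4%N => b1
  | 1%N, 3%N, 3%N => b1 *+ 2
  | 2%N, 2%N, 3%N => b1 *- 2
  | 0%N, 3%N, 5%N => b2
  | 0%N, 4%N, 4%N => b2 *- 2
  | 1%N, 2%N, 5%N => - b2
  | 1%N, 3%N, 4%N => b2
  | 2%N, 2%N, 4%N => b2 *+ 2
  | 2%N, 3%N, 3%N => b2 *- 2
  | 1%N, 3%N, 5%N => b3
  | 1%N, 4%N, 4%N => b3 *- 2
  | 2%N, 2%N, 5%N => b3 *- 2
  | 2%N, 3%N, 4%N => b3 *+ 2
  | 3%N, 3%N, 3%N => b3 *- 6
  | _, _, _ => 0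
  end.

Definition hankel_tensor (R : pzRingType) (b0 b1 b2 b3 : R) :=
  sort3 (hankel_table b0 b1 b2 b3).

(* The sum of s q r over q, r < 6 with q + r = w, in a form that [cbn] unfolds. *)
Definition antidiagonal_sum (R : nmodType) (s : nat -> nat -> R) w :=
  foldr (fun q x => (if Nat.leb q w && Nat.leb (Nat.sub w q) 5
                     then s q (Nat.sub w q) else 0) + x) 0 (iota 0 6).

(** * Elimination in the linear system *)

(** One elimination step: in the equation [e = 0] the unknown [x] has coefficient [c.+1], which is
    invertible in characteristic zero. *)
Lemma solve_linear (K : numFieldType) (c : nat) (e x v : K) :
  e = 0 -> (x - v) *+ c.+1 = e -> x = v.
Proof. by move=> -> /eqP; rewrite mulrn_eq0 subr_eq0 => /eqP. Qed.

(** [known] lists the solved entries to substitute; [addr0] is a placeholder when there are none. *)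
Ltac pivot c e known :=
  apply: (solve_linear (c := c) e); cbn; rewrite ?known; ring.

Lemma hankel_tensor_unique (K : numFieldType) (t : nat -> nat -> nat -> K) :
  symmetric3 t ->
  (forall p w, (p < 6)%N -> (w < 11)%N -> antidiagonal_sum (t p) w = 0) ->
  forall i j k, (i < 6)%N -> (j < 6)%N -> (k < 6)%N ->
    t i j k = hankel_tensor (t 0 2 4)%N (t 0 2 5)%N (t 0 3 5)%N (t 1 3 5)%N i j k.
Proof.
move=> ts te i j k.
(* Sorting the indices identifies entries equal by symmetry, so that [ring] sees one unknown for
   each of them. *)
have E p w : (p < 6)%N -> (w < 11)%N -> antidiagonal_sum (sort3 t p) w = 0.
  move=> lp lw; rewrite -(te p w lp lw) /antidiagonal_sum.
  by elim: (iota 0 6) => //= q r ->; rewrite -(sort3E ts).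
(* The equation [E p w] involves only entries of weight [p + w]. Weights are treated in increasing
   order; 6, 7, 8 and 9 each keep one free entry, and every other entry is solved for. *)
have t000 : (t 0 0 0)%N = 0 by pivot 0%N (E 0 0 isT isT)%N addr0.
have t001 : (t 0 0 1)%N = 0 by pivot 1%N (E 0 1 isT isT)%N addr0.
have t011 : (t 0 1 1)%N = 0 by pivot 1%N (E 1 1 isT isT)%N addr0.
have t002 : (t 0 0 2)%N = 0 by pivot 0%N (E 2 0 isT isT)%N addr0.
have t012 : (t 0 1 2)%N = 0 by pivot 1%N (E 2 1 isT isT)%N addr0.
have t003 : (t 0 0 3)%N = 0 by pivot 0%N (E 3 0 isT isT)%N addr0.
have t111 : (t 1 1 1)%N = 0 by pivot 0%N (E 1 2 isT isT)%N t012.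
have t013 : (t 0 1 3)%N = 0 by pivot 1%N (E 3 1 isT isT)%N addr0.
have t004 : (t 0 0 4)%N = 0 by pivot 0%N (E 4 0 isT isT)%N addr0.
have t022 : (t 0 2 2)%N = 0 by pivot 0%N (E 0 4 isT isT)%N (t004, t013).
have t112 : (t 1 1 2)%N = 0 by pivot 1%N (E 1 3 isT isT)%N t013.
have t014 : (t 0 1 4)%N = 0 by pivot 1%N (E 4 1 isT isT)%N addr0.
have t005 : (t 0 0 5)%N = 0 by pivot 0%N (E 5 0 isT isT)%N addr0.
have t023 : (t 0 2 3)%N = 0 by pivot 1%N (E 0 5 isT isT)%N (t005, t014).
have t122 : (t 1 2 2)%N = 0 by pivot 1%N (E 2 3 isT isT)%N t023.
have t113 : (t 1 1 3)%N = 0 by pivot 0%N (E 3 2 isT isT)%N t023.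
have t114 : (t 1 1 4)%N = (t 0 2 4)%N *- 2.
  by pivot 0%N (E 4 2 isT isT)%N addr0.
have t015 : (t 0 1 5)%N = 0 by pivot 1%N (E 5 1 isT isT)%N addr0.
have t033 : (t 0 3 3)%N = (t 0 2 4)%N *- 2.
  by pivot 0%N (E 0 6 isT isT)%N t015.
have t123 : (t 1 2 3)%N = (t 0 2 4)%N *+ 2.
  by pivot 1%N (E 1 5 isT isT)%N (t015, t114).
have t222 : (t 2 2 2)%N = (t 0 2 4)%N *- 6.
  by pivot 0%N (E 2 4 isT isT)%N t123.
have t034 : (t 0 3 4)%N = - (t 0 2 5)%N.
  by pivot 1%N (E 0 7 isT isT)%N addr0.
have t124 : (t 1 2 4)%N = (t 0 2 5)%N.
  by pivot 1%N (E 4 3 isT isT)%N t034.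
have t115 : (t 1 1 5)%N = (t 0 2 5)%N *- 2.
  by pivot 0%N (E 5 2 isT isT)%N addr0.
have t133 : (t 1 3 3)%N = (t 0 2 5)%N *+ 2.
  by pivot 0%N (E 1 6 isT isT)%N (t115, t124).
have t223 : (t 2 2 3)%N = (t 0 2 5)%N *- 2.
  by pivot 1%N (E 2 5 isT isT)%N t124.
have t044 : (t 0 4 4)%N = (t 0 3 5)%N *- 2.
  by pivot 0%N (E 0 8 isT isT)%N addr0.
have t125 : (t 1 2 5)%N = - (t 0 3 5)%N.
  by pivot 1%N (E 5 3 isT isT)%N addr0.
have t134 : (t 1 3 4)%N = (t 0 3 5)%N.
  by pivot 1%N (E 1 7 isT isT)%N t125.
have t233 : (t 2 3 3)%N = (t 0 3 5)%N *- 2.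
  by pivot 1%N (E 3 5 isT isT)%N t134.
have t224 : (t 2 2 4)%N = (t 0 3 5)%N *+ 2.
  by pivot 0%N (E 4 4 isT isT)%N (t044, t134).
have t045 : (t 0 4 5)%N = 0 by pivot 1%N (E 0 9 isT isT)%N addr0.
have t144 : (t 1 4 4)%N = (t 1 3 5)%N *- 2.
  by pivot 0%N (E 1 8 isT isT)%N addr0.
have t234 : (t 2 3 4)%N = (t 1 3 5)%N *+ 2.
  by pivot 1%N (E 4 5 isT isT)%N (t045, t144).
have t225 : (t 2 2 5)%N = (t 1 3 5)%N *- 2.
  by pivot 0%N (E 5 4 isT isT)%N t045.
have t333 : (t 3 3 3)%N = (t 1 3 5)%N *- 6.
  by pivot 0%N (E 3 6 isT isT)%N t234.
have t055 : (t 0 5 5)%N = 0 by pivot 0%N (E 0 10 isT isT)%N addr0.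
have t145 : (t 1 4 5)%N = 0 by pivot 1%N (E 1 9 isT isT)%N addr0.
have t235 : (t 2 3 5)%N = 0 by pivot 1%N (E 5 5 isT isT)%N (t055, t145).
have t244 : (t 2 4 4)%N = 0 by pivot 0%N (E 2 8 isT isT)%N t235.
have t334 : (t 3 3 4)%N = 0 by pivot 1%N (E 3 7 isT isT)%N t235.
have t155 : (t 1 5 5)%N = 0 by pivot 0%N (E 1 10 isT isT)%N addr0.
have t245 : (t 2 4 5)%N = 0 by pivot 1%N (E 2 9 isT isT)%N addr0.
have t344 : (t 3 4 4)%N = 0 by pivot 1%N (E 4 7 isT isT)%N t245.
have t335 : (t 3 3 5)%N = 0 by pivot 0%N (E 5 6 isT isT)%N (t155, t245).
have t255 : (t 2 5 5)%N = 0 by pivot 0%N (E 2 10 isT isT)%N addr0.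
have t345 : (t 3 4 5)%N = 0 by pivot 1%N (E 3 9 isT isT)%N addr0.
have t444 : (t 4 4 4)%N = 0 by pivot 0%N (E 4 8 isT isT)%N t345.
have t355 : (t 3 5 5)%N = 0 by pivot 0%N (E 3 10 isT isT)%N addr0.
have t445 : (t 4 4 5)%N = 0 by pivot 1%N (E 4 9 isT isT)%N addr0.
have t455 : (t 4 5 5)%N = 0 by pivot 0%N (E 4 10 isT isT)%N addr0.
have t555 : (t 5 5 5)%N = 0 by pivot 0%N (E 5 10 isT isT)%N addr0.
rewrite (sort3E ts).
case: i => [|[|[|[|[|[|//]]]]]] _; case: j => [|[|[|[|[|[|//]]]]]] _;
  case: k => [|[|[|[|[|[|//]]]]]] _; cbn; by [].
Qed.

(** * From vanishing on the curve to linear equations *)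

Lemma poly_vanishing_eq0 (K : numFieldType) (p : {poly K}) :
  (forall s, p.[s] = 0) -> p = 0.
Proof.
move=> p0; pose rs := [seq i%:R : K | i <- iota 0 (size p)].
apply: (@roots_geq_poly_eq0 _ p rs); rewrite ?size_map ?size_iota //.
  by apply/allP => x _; apply/eqP/p0.
rewrite map_inj_uniq ?iota_uniq // => i j /eqP.
by rewrite eqr_nat => /eqP.
Qed.

Lemma sum6E (V : nmodType) (g : 'I_6 -> V) :
  \sum_i g i = g (inord 0) + (g (inord 1) + (g (inord 2) +
    (g (inord 3) + (g (inord 4) + g (inord 5))))).
Proof.
rewrite !big_ord_recl big_ord0 addr0.
by do ![congr (_ + _)]; congr g; apply/val_inj; rewrite /= inordK.
Qed.

(** The double sum is a polynomial of degree at most 10 in [s], with the antidiagonal sums as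
    coefficients; a polynomial vanishing at every point of an infinite field is zero. *)
Lemma antidiagonal_sum_eq0 (K : numFieldType) (f : 'I_6 -> 'I_6 -> K) :
  (forall s : K, \sum_(q < 6) s ^+ q * (\sum_(r < 6) s ^+ r * f q r) = 0) ->
  forall w, (w < 11)%N -> antidiagonal_sum (fun q r => f (inord q) (inord r)) w = 0.
Proof.
move=> f0; set c := antidiagonal_sum _.
suff p0 : \poly_(w < 11) c w = 0.
  by move=> w lw; have := coef_poly 11 c w; rewrite p0 coef0 lw.
apply: poly_vanishing_eq0 => s; rewrite -[RHS](f0 s) horner_poly.
rewrite !sum6E !inordK // -(big_mkord xpredT (fun w => c w * s ^+ w)).
rewrite /index_iota subn0 !big_cons big_nil /c; cbn.
ring.
Qed.

(** * Hankel minors and 3 x 3 determinants *)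

(** This certifies [hankel_table]: [m i j k] is the Hankel minor on columns i, j, k. A general ring
    allows linear forms as values of [y]. *)
Lemma hankel_cubic (R : comPzRingType) (b0 b1 b2 b3 : R) (y : 'I_6 -> R) :
  let x (i : nat) := y (inord i) in
  let m i j k := x i * (x j.+1 * x k.+2 - x k.+1 * x j.+2)
     - x j * (x i.+1 * x k.+2 - x k.+1 * x i.+2)
     + x k * (x i.+1 * x j.+2 - x j.+1 * x i.+2) in
  \sum_(p < 6) y p * (\sum_(q < 6) y q * (\sum_(r < 6) y r * hankel_tensor b0 b1 b2 b3 p q r)) =
  (b0 * (m 0 1 2)%N + b1 * (m 0 1 3)%N + b2 * (m 0 2 3)%N + b3 * (m 1 2 3)%N) *+ 6.
Proof.
rewrite /=; rewrite !sum6E !inordK //; cbn.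
ring.
Qed.

Lemma det_columns3 (R : comPzRingType) (c0 c1 c2 : nat -> R) :
  \det (\matrix_(i < 3, j < 3) nth 0 [:: c0 i; c1 i; c2 i] j) =
    c0 0%N * (c1 1%N * c2 2%N - c2 1%N * c1 2%N)
  - c1 0%N * (c0 1%N * c2 2%N - c2 1%N * c0 2%N)
  + c2 0%N * (c0 1%N * c1 2%N - c1 1%N * c0 2%N).
Proof.
rewrite (expand_det_row _ ord0) !big_ord_recl big_ord0 /cofactor.
rewrite !(expand_det_row _ ord0) !big_ord_recl !big_ord0 /cofactor !det_mx11.
rewrite !mxE /= /bump /= !addn0 !add1n /=; ring.
Qed.

(** * The line of singular points *)

(** On this line every row of [H(u); a] is orthogonal to (q_0, q_1, q_2, 0) and (0, q_0, q_1, q_2),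
    so all 3 x 3 minors vanish, and with them the gradient of the determinant. The proof
    parametrizes the line according to the last nonzero q_i and checks the vanishing by
    expansion. *)
Lemma hankel_singular_line (K : fieldType) (b0 b1 b2 b3 : K) :
  exists2 U : 'M[K]_(2, 6), row_free U &
    forall (w : 'rV[K]_2) (p : 'I_6), let u := (w *m U) 0 in
    \sum_(q < 6) u q * (\sum_(r < 6) u r * hankel_tensor b0 b1 b2 b3 p q r) = 0.
Proof.
pose U (f g : seq K) : 'M[K]_(2, 6) :=
  \matrix_(i, j) if i == 0 then f`_j else g`_j.
have uE f g (w : 'rV_2) j : (w *m U f g) 0 j = w 0 0 * f`_j + w 0 1 * g`_j.
  rewrite !mxE !big_ord_recl big_ord0 !mxE addr0 /=.
  by congr (_ + w 0 _ * _); apply/val_inj.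
(* Columns [i] and [j] of [U f g] form an identity block. *)
have freeU f g (i j : 'I_6) :
    f`_i = 1 -> g`_i = 0 -> f`_j = 0 -> g`_j = 1 -> row_free (U f g).
  move=> fi gi fj gj; rewrite -kermx_eq0; apply/rowV0P => w /sub_kermxP w0.
  apply/rowP => k; rewrite mxE.
  have := uE f g w i; rewrite w0 fi gi mxE mulr0 addr0 mulr1 => w00.
  have := uE f g w j; rewrite w0 fj gj mxE mulr0 add0r mulr1 => w01.
  by case: k => [[|[|//]]] k; [rewrite [RHS]w00|rewrite [RHS]w01];
    congr (w _ _); apply/val_inj.
(* [a] is the row for which the cubic is det [H(x); a]. *)
pose a := [:: - b3; b2; - b1; b0].
pose N : 'M[K]_(3, 2) := \matrix_(i, j) a`_(i + j).
have /rowV0Pn[q /sub_kermxP qN q0] : kermx N != 0.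
  rewrite -mxrank_eq0 mxrank_ker subn_eq0 -ltnNge.
  by rewrite (leq_ltn_trans (rank_leq_col _)).
have qE (j : 'I_2) : q 0 (inord 0) * a`_j + q 0 (inord 1) * a`_j.+1 +
    q 0 (inord 2) * a`_j.+2 = 0.
  have := congr1 (fun M : 'rV_2 => M 0 j) qN.
  rewrite mxE !big_ord_recl big_ord0 !mxE addr0 addrA => qNj; rewrite -[RHS]qNj.
  by do ![congr (_ + _)]; congr (q _ _ * _);
    first [by [] | by apply/val_inj; rewrite /= inordK].
have := qE 1; have {qE} := qE 0; rewrite /=.
set q_0 := q 0 (inord 0); set q_1 := q 0 (inord 1); set q_2 := q 0 (inord 2).
move=> e0 e1.
have [q20|q2n0] := eqVneq q_2 0; last first.
  (* The recurrence is x_(j+2) = al x_j + be x_(j+1): [rec] runs it from two initial values, and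
     applied to [a] it eliminates [b1] and [b0]. *)
  pose al := - q_0 / q_2; pose be := - q_1 / q_2.
  have b1E : b1 = al * b3 - be * b2.
    apply: subr0_eq; rewrite -[RHS](mulr0 (- q_2^-1)) -e0 /al /be.
    by field.
  have b0E : b0 = al * b2 - be * b1.
    apply: subr0_eq; rewrite -[RHS](mulr0 (q_2^-1)) -e1 /al /be.
    by field.
  pose rec x y := let z := al * x + be * y in let t := al * y + be * z in
    let v := al * z + be * t in [:: x; y; z; t; v; al * t + be * v].
  exists (U (rec 1 0) (rec 0 1)).
    by apply: (freeU _ _ (inord 0) (inord 1)); rewrite inordK.
  move=> w p /=; rewrite !sum6E !uE !inordK // b0E b1E /rec /=.
  by case: p => [[|[|[|[|[|[|//]]]]]]] ?; cbn; ring.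
have [q10|q1n0] := eqVneq q_1 0.
  have q0n0 : q_0 != 0.
    apply: contra_neq q0 => q00; apply/rowP => k; rewrite mxE.
    rewrite -[k]inord_val.
    by case: k => [[|[|[|//]]]] ?.
  move: e0 e1; rewrite q10 q20 !mul0r !addr0 => /eqP + /eqP.
  rewrite !mulf_eq0 (negPf q0n0) oppr_eq0 /= => /eqP-> /eqP->.
  (* The recurrence is x_0 = ... = x_3 = 0: the tangent line at (0 : ... : 0 : 1). *)
  exists (U [:: 0; 0; 0; 0; 1; 0] [:: 0; 0; 0; 0; 0; 1]).
    by apply: (freeU _ _ (inord 4) (inord 5)); rewrite inordK.
  move=> w p /=; rewrite !sum6E !uE !inordK //=.
  by case: p => [[|[|[|[|[|[|//]]]]]]] ?; cbn; ring.
(* The recurrence x_(j+1) = ga x_j for j < 4 leaves x_5 free: the secant through (1 : ga : ... :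
   ga^5) and (0 : ... : 0 : 1). *)
pose ga := - q_0 / q_1.
have b2E : b2 = - ga * b3.
  by apply: subr0_eq; rewrite -[RHS](mulr0 (q_1^-1)) -e0 q20 /ga; field.
have b1E : b1 = - ga * b2.
  by apply: subr0_eq; rewrite -[RHS](mulr0 (- q_1^-1)) -e1 q20 /ga; field.
exists (U [:: 1; ga; ga ^+ 2; ga ^+ 3; ga ^+ 4; 0] [:: 0; 0; 0; 0; 0; 1]).
  by apply: (freeU _ _ (inord 0) (inord 5)); rewrite inordK.
move=> w p /=; rewrite !sum6E !uE !inordK // b1E b2E /=.
by case: p => [[|[|[|[|[|[|//]]]]]]] ?; cbn; ring.
Qed.

(** * Euler's identity and homogeneous derivatives *)

Lemma mpoly_euler (n d : nat) (K : comNzRingType) (F : {mpoly K[n]}) :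
  F \is d.-homog -> F *+ d = \sum_i 'X_i * F^`M(i).
Proof.
move=> /dhomogP hF; pose G := \sum_(m <- msupp F) F@_m *: 'X_[m].
have FE : F = G := mpolyE F.
have dE i : F^`M(i) = \sum_(m <- msupp F) F@_m *: ('X_[m])^`M(i).
  by rewrite {1}FE /G linear_sum; apply: eq_bigr => m _; rewrite linearZ.
rewrite (eq_bigr _ (fun i _ => congr1 (fun P => 'X_i * P) (dE i))).
under eq_bigr => i _ do rewrite mulr_sumr.
rewrite exchange_big {1}FE /G -sumrMnl; apply: eq_big_seq => m /hF hm.
rewrite /= in hm; rewrite -hm mdegE -sumrMnr; apply: eq_bigr => i _.
rewrite mderivX -scalerAr scalerMnr; congr (_ *: _).
(* If [m i = 0], the exponent subtraction truncates, but its coefficient is zero. *)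
have [->|mi] := eqVneq (m i) 0%N; first by rewrite scale0r mulr0.
by rewrite -scalerAr scaler_nat -mpolyXD addmC submK ?lep1mP.
Qed.

Lemma dhomog_mderiv (n d : nat) (K : comNzRingType) (F : {mpoly K[n]}) i :
  F \is d.+1.-homog -> F^`M(i) \is d.-homog.
Proof.
move=> /dhomogP hF; apply/dhomogP => m.
rewrite mcoeff_msupp mcoeff_mderiv => nz.
have /hF : (m + U_(i))%MM \in msupp F.
  by rewrite mcoeff_msupp; apply: contra_neq nz => ->; rewrite mul0rn.
by rewrite /= mdegD mdeg1 addn1 => -[].
Qed.

Lemma dhomog0_const (n : nat) (K : comNzRingType) (F : {mpoly K[n]}) :
  F \is 0.-homog -> F = (F@_0)%:MP.
Proof.
move=> hF; apply/mpolyP => m; rewrite mcoeffC.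
have [->|m0] := eqVneq m 0%MM; first by rewrite mulr1.
rewrite mulr0; apply: dhomog_nemf_coeff hF _.
by rewrite /= mdeg_eq0.
Qed.

(** * Contractions of tensors and change of basis *)

Section Tensors.

Variables (R : comPzRingType) (n : nat) (A : 'M[R]_n).
Implicit Types (x y : 'I_n -> R) (T : 'I_n -> 'I_n -> 'I_n -> R).

(** For symmetric [T], three times this is the partial derivative in direction [i] of the cubic form
    of [T]. The nested sums let indices be exchanged one at a time. *)
Definition quadratic_slice T (x : 'I_n -> R) i : R :=
  \sum_j x j * (\sum_k x k * T i j k).

Definition change_basis T p q r : R :=
  \sum_i A p i * (\sum_j A q j * (\sum_k A r k * T i j k)).

Lemma swap_contractions x y (g : 'I_n -> 'I_n -> R) :
  \sum_i x i * (\sum_j y j * g i j) = \sum_j y j * (\sum_i x i * g i j).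
Proof.
under eq_bigr => i _ do rewrite mulr_sumr.
rewrite exchange_big; apply: eq_bigr => j _; rewrite mulr_sumr.
by apply: eq_bigr => i _; rewrite mulrCA.
Qed.

Lemma contract_change_basis x y (g : 'I_n -> R) :
  (forall i, x i = \sum_p y p * A p i) ->
  \sum_i x i * g i = \sum_p y p * (\sum_i A p i * g i).
Proof.
move=> xE; under [RHS]eq_bigr => p _ do rewrite mulr_sumr.
rewrite exchange_big; apply: eq_bigr => i _; rewrite xE mulr_suml.
by apply: eq_bigr => p _; rewrite mulrA.
Qed.

(** The chain rule for the substitution x = y A. *)
Lemma quadratic_slice_change_basis T x y p :
  (forall i, x i = \sum_p y p * A p i) ->
  \sum_i A p i * quadratic_slice T x i = quadratic_slice (change_basis T) y p.
Proof.
move=> xE; have sliceE i : quadratic_slice T x i =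
    \sum_q y q * (\sum_r y r * (\sum_j A q j * (\sum_k A r k * T i j k))).
  rewrite /quadratic_slice (contract_change_basis _ xE).
  apply: eq_bigr => q _; congr (_ * _); rewrite [RHS]swap_contractions.
  apply: eq_bigr => j _; congr (_ * _).
  exact: contract_change_basis.
under eq_bigr => i _ do rewrite sliceE.
rewrite swap_contractions; apply: eq_bigr => q _.
by rewrite swap_contractions.
Qed.

Lemma cubic_change_basis T x y :
  (forall i, x i = \sum_p y p * A p i) ->
  \sum_i x i * quadratic_slice T x i =
  \sum_p y p * quadratic_slice (change_basis T) y p.
Proof.
move=> xE; rewrite (contract_change_basis _ xE); apply: eq_bigr => p _.
by rewrite (quadratic_slice_change_basis T p xE).
Qed.

Lemma symmetric3_change_basis T :
  symmetric3 T -> symmetric3 (change_basis T).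
Proof.
case=> s1 s2; split=> p q r; rewrite /change_basis.
  rewrite swap_contractions; apply: eq_bigr => j _; congr (_ * _).
  apply: eq_bigr => i _; congr (_ * _); apply: eq_bigr => k _.
  by rewrite s1.
apply: eq_bigr => i _; congr (_ * _); rewrite swap_contractions.
apply: eq_bigr => j _; congr (_ * _); apply: eq_bigr => k _; congr (_ * _).
by rewrite s2.
Qed.

End Tensors.

(** * Cubic forms and their polar tensors *)

Section CubicForms.

Variables (K : numFieldType) (n : nat) (F : {mpoly K[n.+1]}).
Hypothesis hF : F \is 3.-homog.

Definition polar_tensor i j k : K := (F^`M(i)^`M(j)^`M(k))@_0.

Lemma symmetric3_polar_tensor : symmetric3 polar_tensor.
Proof.
split=> i j k; rewrite /polar_tensor; first by rewrite (mderiv_comm i).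
by rewrite (mderiv_comm j).
Qed.

(** Constant polynomials, so that slices can be taken at the generic point. *)
Definition polar_tensorC i j k : {mpoly K[n.+1]} := (polar_tensor i j k)%:MP.

(** Euler's identity in degrees 2 and 1; the third derivatives are constants. *)
Lemma mderiv_polar i :
  F^`M(i) *+ 2 = quadratic_slice polar_tensorC (fun j => 'X_j) i.
Proof.
rewrite (mpoly_euler (dhomog_mderiv i hF)); apply: eq_bigr => j _.
have hij := dhomog_mderiv j (dhomog_mderiv i hF).
congr (_ * _); rewrite -[LHS]mulr1n (mpoly_euler hij).
apply: eq_bigr => k _; congr (_ * _); apply: dhomog0_const.
exact: dhomog_mderiv.
Qed.

Lemma cubic_polar :
  F *+ 6 = \sum_i 'X_i * quadratic_slice polar_tensorC (fun j => 'X_j) i.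
Proof.
rewrite (mulrnA F 3 2) (mpoly_euler hF) -sumrMnl.
by apply: eq_bigr => i _; rewrite -mderiv_polar mulrnAr.
Qed.

Lemma meval_slice v i :
  (quadratic_slice polar_tensorC (fun j => 'X_j) i).@[v] =
  quadratic_slice polar_tensor v i.
Proof.
rewrite /quadratic_slice raddf_sum; apply: eq_bigr => j _ /=.
rewrite mevalM mevalXU raddf_sum; congr (_ * _); apply: eq_bigr => k _ /=.
by rewrite mevalM mevalXU mevalC.
Qed.

Lemma singular_at_polar v : singular_at F v <->
  forall i, quadratic_slice polar_tensor (v ord0) i = 0.
Proof.
split=> [[_ dF0] i|Q0].
  by rewrite -meval_slice -mderiv_polar raddfMn /= dF0 mul0rn.
have dF0 i : (F^`M(i)).@[v ord0] = 0.
  suff /eqP : (F^`M(i)).@[v ord0] *+ 2 = 0 by rewrite mulrn_eq0 => /eqP.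
  by rewrite -raddfMn /= mderiv_polar meval_slice Q0.
split=> //; suff /eqP : F.@[v ord0] *+ 6 = 0 by rewrite mulrn_eq0 => /eqP.
rewrite -raddfMn /= cubic_polar.
rewrite raddf_sum big1 // => i _ /=.
by rewrite mevalM meval_slice Q0 mulr0.
Qed.

(** The new gradient is [A] times the old one, and [A] is invertible. *)
Lemma singular_at_change_basis (A : 'M[K]_n.+1) (u : 'rV[K]_n.+1) :
  A \in unitmx ->
  singular_at F (u *m A) <->
  forall p, quadratic_slice (change_basis A polar_tensor) (u ord0) p = 0.
Proof.
move=> uA; have vE i : (u *m A) ord0 i = \sum_p u ord0 p * A p i by rewrite mxE.
rewrite singular_at_polar; split=> Q0.
  move=> p; rewrite -(quadratic_slice_change_basis _ _ vE) big1 // => i _.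
  by rewrite Q0 mulr0.
pose Q := \col_i quadratic_slice polar_tensor ((u *m A) ord0) i.
have AQ0 : A *m Q = 0.
  apply/colP => p; rewrite !mxE -[RHS](Q0 p).
  rewrite -(quadratic_slice_change_basis _ _ vE).
  by apply: eq_bigr => i _; rewrite mxE.
have Qz : Q = 0 by rewrite -(mulKmx uA Q) AQ0 mulmx0.
by move=> i; have := congr1 (fun M : 'cV_n.+1 => M i 0) Qz; rewrite !mxE.
Qed.

(** Points are row vectors with x = y A, hence y = x A^-1. *)
Definition new_coordinates (A : 'M[K]_n.+1) (p : 'I_n.+1) : {mpoly K[n.+1]} :=
  \sum_i (invmx A i p) *: 'X_i.

Lemma new_coordinates_dhomog A p : new_coordinates A p \is 1.-homog.
Proof.
apply: rpred_sum => i _; apply: rpredZ.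
by rewrite dhomogX /= mdeg1.
Qed.

Lemma cubic_change_coordinates (A : 'M[K]_n.+1) : A \in unitmx ->
  let y := new_coordinates A in
  F *+ 6 = \sum_p y p * (\sum_q y q *
    (\sum_r y r * (change_basis A polar_tensor p q r)%:MP)).
Proof.
move=> uA y; rewrite cubic_polar.
pose AC := map_mx (mpolyC n.+1 (R := K)) A.
have XE i : 'X_i = \sum_p y p * AC p i.
  transitivity (\sum_j (invmx A *m A) j i *: 'X_j : {mpoly K[n.+1]}).
    rewrite mulVmx // (bigD1 i) //= mxE eqxx scale1r big1 ?addr0 // => j /negPf ji.
    by rewrite mxE ji scale0r.
  under eq_bigr => j _ do rewrite mxE scaler_suml.
  rewrite exchange_big; apply: eq_bigr => p _; rewrite mulr_suml.
  by apply: eq_bigr => j _; rewrite mxE [RHS]mulrC mul_mpolyC scalerA mulrC.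
rewrite (cubic_change_basis _ XE).
apply: eq_bigr => p _; congr (_ * _); apply: eq_bigr => q _; congr (_ * _).
apply: eq_bigr => r _; congr (_ * _); rewrite /change_basis.
rewrite raddf_sum; apply: eq_bigr => i _ /=; rewrite rmorphM mxE; congr (_ * _).
rewrite raddf_sum; apply: eq_bigr => j _ /=; rewrite rmorphM mxE; congr (_ * _).
by rewrite raddf_sum; apply: eq_bigr => k _ /=; rewrite rmorphM mxE.
Qed.

End CubicForms.

(** * Determinantal form of a Hankel cubic *)

Lemma raddf_hankel_tensor (R S : pzRingType) (f : {additive R -> S})
    b0 b1 b2 b3 i j k :
  f (hankel_tensor b0 b1 b2 b3 i j k) =
  hankel_tensor (f b0) (f b1) (f b2) (f b3) i j k.
Proof.
have tableE x y z : f (hankel_table b0 b1 b2 b3 x y z) =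
    hankel_table (f b0) (f b1) (f b2) (f b3) x y z.
  case: x => [|[|[|[|x]]]]; case: y => [|[|[|[|[|y]]]]];
    case: z => [|[|[|[|[|[|z]]]]]] /=;
    by rewrite ?raddfMNn ?raddfMn ?raddfN ?raddf0.
by rewrite /hankel_tensor /sort3; do 3![case: Nat.leb; rewrite ?tableE].
Qed.

(* By multilinearity of the determinant, a combination of the maximal minors of
   a 3 x 4 matrix is a single minor after a column operation that pivots on a
   column omitted by a minor with nonzero coefficient. *)
Lemma hankel_cubic_determinantal (K : numFieldType) (F : {mpoly K[6]})
    (b0 b1 b2 b3 : K) (y : 'I_6 -> {mpoly K[6]}) :
  (forall p, y p \is 1.-homog) ->
  F *+ 6 = \sum_(p < 6) y p * (\sum_(q < 6) y q *
    (\sum_(r < 6) y r * (hankel_tensor b0 b1 b2 b3 p q r)%:MP)) ->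
  determinantal F.
Proof.
move=> hy FE; pose h j i : {mpoly K[6]} := y (inord (j + i)).
have hh c j i : c *: h j i \is 1.-homog by apply: rpredZ; apply: hy.
pose m i j k := h i 0%N * (h j 1%N * h k 2%N - h k 1%N * h j 2%N)
  - h j 0%N * (h i 1%N * h k 2%N - h k 1%N * h i 2%N)
  + h k 0%N * (h i 1%N * h j 2%N - h j 1%N * h i 2%N).
have {}FE : F = b0%:MP * (m 0 1 2)%N + b1%:MP * (m 0 1 3)%N
    + b2%:MP * (m 0 2 3)%N + b3%:MP * (m 1 2 3)%N.
  apply: (@scalerI _ _ 6%:R); rewrite ?pnatr_eq0 // !scaler_nat FE.
  rewrite -(hankel_cubic b0%:MP b1%:MP b2%:MP b3%:MP y).
  apply: eq_bigr => p _; congr (_ * _); apply: eq_bigr => q _; congr (_ * _).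
  by apply: eq_bigr => r _; rewrite raddf_hankel_tensor.
(* The Hankel structure of [h] is forgotten; what remains is a 3 x 4 matrix of linear forms. *)
move: h hh @m FE => h hh m FE.
have det_cols (c0 c1 c2 : nat -> {mpoly K[6]}) :
    (forall i, c0 i \is 1.-homog) -> (forall i, c1 i \is 1.-homog) ->
    (forall i, c2 i \is 1.-homog) ->
    F = c0 0%N * (c1 1%N * c2 2%N - c2 1%N * c1 2%N)
      - c1 0%N * (c0 1%N * c2 2%N - c2 1%N * c0 2%N)
      + c2 0%N * (c0 1%N * c1 2%N - c1 1%N * c0 2%N) ->
    determinantal F.
  move=> hc0 hc1 hc2 {}FE.
  exists (\matrix_(i < 3, j < 3) nth 0 [:: c0 i; c1 i; c2 i] j).
    move=> i [[|[|[|//]]]] ?; rewrite mxE; [exact: hc0|exact: hc1|exact: hc2].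
  by rewrite det_columns3.
have hD (p q : {mpoly K[6]}) :
    p \is 1.-homog -> q \is 1.-homog -> p + q \is 1.-homog.
  exact: rpredD.
have [b00|b0n0] := eqVneq b0 0; last first.
  (* The pivot is column 3; the sign in [be] comes from [032] = - [023]. *)
  pose be := - b2 / b0; pose ga := b1 / b0.
  have b2E : b2 = - be * b0 by rewrite /be; field.
  have b1E : b1 = ga * b0 by rewrite /ga; field.
  clearbody be ga.
  apply: (det_cols (fun i => b0 *: h 0%N i + b3 *: h 3%N i)
    (fun i => 1 *: h 1%N i + be *: h 3%N i)
    (fun i => 1 *: h 2%N i + ga *: h 3%N i)) => [i|i|i|]; try exact: hD.
  by rewrite FE b1E b2E !scale1r -!mul_mpolyC !mpolyCM mpolyCN /m; ring.
have [b10|b1n0] := eqVneq b1 0; last first.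
  pose be := b2 / b1.
  have b2E : b2 = be * b1 by rewrite /be; field.
  clearbody be.
  apply: (det_cols (fun i => b1 *: h 0%N i + (- b3) *: h 2%N i)
    (fun i => 1 *: h 1%N i + be *: h 2%N i)
    (fun i => 1 *: h 3%N i)) => [i|i|i|]; [exact: hD|exact: hD|exact: hh|].
  by rewrite FE b00 b2E !scale1r -!mul_mpolyC !mpolyCM mpolyCN /m; ring.
(* Without division: b2 [023] + b3 [123] is linear in the first column, whether or not [b2]
   vanishes. *)
apply: (det_cols (fun i => b2 *: h 0%N i + b3 *: h 1%N i)
  (fun i => 1 *: h 2%N i) (fun i => 1 *: h 3%N i)) => [i|i|i|];
  [exact: hD|exact: hh|exact: hh|].
by rewrite FE b00 b10 !scale1r -!mul_mpolyC /m; ring.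
Qed.

(** * Cubic fourfolds singular along a rational normal quintic *)

Theorem lemma6p13 (R : realType) (F : {mpoly (complex R)[6]})
    (C : projset (complex R) 5) :
  cubic_fourfold F ->
  rational_normal_curve C ->
  singular_along (n := 5) F C ->
  determinantal F /\
  exists L : projset (complex R) 5,
    projective_line L /\ singular_along (n := 5) F L.
Proof.
move=> [_ hF] [A uA CE] sF.
pose T := change_basis A (polar_tensor F).
have symT : symmetric3 T.
  exact/symmetric3_change_basis/symmetric3_polar_tensor.
have sing u := singular_at_change_basis hF u uA.
(* Natural number indices allow evaluation on numerals; [inord] sends those above 5 to 0, which
   preserves symmetry. *)
pose t i j k := T (inord i) (inord j) (inord k).
have slice0 p w : (w < 11)%N -> antidiagonal_sum (t p) w = 0.
  apply: (@antidiagonal_sum_eq0 _ (T (inord p))) => s.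
  have /sing/(_ (inord p)) : singular_at F (veronese 5 1 s *m A).
    apply: sF; apply/CE; exists 1, s, 1; split; rewrite ?scale1r ?oner_eq0 //.
    by rewrite xpair_eqE oner_eq0.
  move=> s0; rewrite -[RHS]s0; apply: eq_bigr => q _; rewrite mxE expr1n mul1r.
  by congr (_ * _); apply: eq_bigr => r _; rewrite mxE expr1n mul1r.
have symt : symmetric3 t.
  by case: symT => s1 s2; split=> i j k; [apply: s1|apply: s2].
have tE := hankel_tensor_unique symt (fun p w _ lw => slice0 p w lw).
have [b0 [b1 [b2 [b3 TE]]]] : exists b0 b1 b2 b3, forall p q r,
    T p q r = hankel_tensor b0 b1 b2 b3 p q r.
  exists (t 0 2 4)%N, (t 0 2 5)%N, (t 0 3 5)%N, (t 1 3 5)%N => p q r.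
  by rewrite -(tE _ _ _ (ltn_ord p) (ltn_ord q) (ltn_ord r)) /t !inord_val.
split.
  apply: (@hankel_cubic_determinantal _ F b0 b1 b2 b3 (new_coordinates A)).
    exact: new_coordinates_dhomog.
  rewrite (cubic_change_coordinates hF uA).
  apply: eq_bigr => p _; congr (_ * _); apply: eq_bigr => q _; congr (_ * _).
  by apply: eq_bigr => r _; rewrite -/T TE.
have [U freeU U0] := hankel_singular_line b0 b1 b2 b3.
(* [U] spans the line in the coordinates of the standard curve; [A] carries it back. *)
exists (fun v => v != 0 /\ (v <= U *m A)%MS); split.
  by exists (U *m A) => //; rewrite /row_free mxrankMfree ?row_free_unit.
move=> v [_ /submxP[w ->]]; rewrite mulmxA; apply/sing => p.
rewrite -[RHS](U0 w p); apply: eq_bigr => q _; congr (_ * _).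
by apply: eq_bigr => r _; rewrite -/T TE.
Qed.
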